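(* Let $G$ be a finitely generated group with arithmetic word problem, and let $\widetilde{\mathbb Z}\equiv\mathbb Z$. Then $G$ is an elementary submodel of $\widetilde G=G(\widetilde{\mathbb Z})$ (via the natural embedding $G\cong\Gamma(\mathbb Z)\to\Gamma(\widetilde{\mathbb Z})=\widetilde G$ induced by the inclusion $\mathbb Z\subseteq\widetilde{\mathbb Z}$).
   Context: An absolute interpretation $\Gamma$ of an $L$-structure $\mathbb A$ in a structure $\mathbb B$ is a family of parameter-free formulas of the language of $\mathbb B$: $U_\Gamma(\bar x)$, $E_\Gamma(\bar x,\bar x')$ and $Q_\Gamma$ for each symbol $Q\in L$ (in $n$-tuples of variables), such that $E_\Gamma$ defines an equivalence relation on the set $U_\Gamma(\mathbb B)\subseteq B^n$, the $Q_\Gamma$ define (the preimages of the graphs of) constants, operations and relations on the quotient, and the resulting $L$-structure $\Gamma(\mathbb B)$ is isomorphic to $\mathbb A$. For $\widetilde{\mathbb B}\equiv\mathbb B$ the same formulas define an $L$-structure $\Gamma(\widetilde{\mathbb B})$. A group $G$ with finite generating set $g_1,\dots,g_k$ has arithmetic word problem if the set of finite group words in $g_1^{\pm1},\dots,g_k^{\pm1}$ equal to $1$ in $G$ is, under a Gödel enumeration of words, definable by a first-order formula in $\langle\mathbb N;+,\cdot,0,1\rangle$. Such a $G$ is absolutely interpretable in the ring $\mathbb Z$ (by codes of group words modulo equality in $G$, multiplication being concatenation). For $\widetilde{\mathbb Z}\equiv\mathbb Z$, the nonstandard model $G(\widetilde{\mathbb Z})$ is the group $\Gamma(\widetilde{\mathbb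 Z})$, where $\Gamma$ is any absolute interpretation of $G$ in $\mathbb Z$; up to isomorphism it does not depend on $\Gamma$. $\mathbb Z$ is regarded as a subring of $\widetilde{\mathbb Z}$ via $n\mapsto n\cdot 1$; this is an elementary embedding. *)

(* Defs.v *)
From HB Require Import structures.
From mathcomp Require Import all_boot all_algebra.
From mathcomp Require Import boolp.

Set Implicit Arguments.
Unset Strict Implicit.
Unset Printing Implicit Defensive.

Local Open Scope ring_scope.

(* Constants are the function symbols of arity 0. *)
Record signature := Signature {
  funsym : Type;
  relsym : Type;
  farity : funsym -> nat;
  rarity : relsym -> nat }.

Record structure (L : signature) := Structure {
  carrier :> Type;
  fun_interp : forall f : funsym L, ('I_(farity f) -> carrier) -> carrier;
  rel_interp : forall r : relsym L, ('I_(rarity r) -> carrier) -> Prop }.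

Inductive term (L : signature) (X : Type) : Type :=
| Var of X
| App (f : funsym L) of 'I_(farity f) -> term L X.

(* [formula L X]: parameter-free first-order formulas whose free variables are
   among X.  A quantifier binds the variable [None] of [option X]. *)
Inductive formula (L : signature) (X : Type) : Type :=
| Falsum
| Equal of term L X & term L X
| Rel (r : relsym L) of 'I_(rarity r) -> term L X
| Imp of formula L X & formula L X
| And of formula L X & formula L X
| Or of formula L X & formula L X
| All of formula L (option X)
| Ex of formula L (option X).

Fixpoint eval (L : signature) (M : structure L) (X : Type) (e : X -> M)
    (t : term L X) : M :=
  match t with
  | Var x => e x
  | App f ts => fun_interp (fun i => eval e (ts i))
  end.

Fixpoint holds (L : signature) (M : structure L) (X : Type)
    (phi : formula L X) : (X -> M) -> Prop :=
  match phi with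
  | Falsum => fun=> False
  | Equal t u => fun e => eval e t = eval e u
  | Rel r ts => fun e => rel_interp (fun i => eval e (ts i))
  | Imp p q => fun e => holds p e -> holds q e
  | And p q => fun e => holds p e /\ holds q e
  | Or p q => fun e => holds p e \/ holds q e
  | All p => fun e => forall a, holds p (oapp e a)
  | Ex p => fun e => exists a, holds p (oapp e a)
  end.

Definition elementarily_equivalent (L : signature) (M N : structure L) : Prop :=
  forall phi : formula L void, holds phi (of_void M) <-> holds phi (of_void N).

Definition elementary_embedding (L : signature) (M N : structure L)
    (h : M -> N) : Prop :=
  forall (n : nat) (phi : formula L 'I_n) (e : 'I_n -> M),
    holds phi e <-> holds phi (h \o e).

Definition isomorphism (L : signature) (M N : structure L) (h : M -> N) : Prop :=
  [/\ bijective h,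
      forall (f : funsym L) (a : 'I_(farity f) -> M),
        h (fun_interp a) = fun_interp (h \o a) &
      forall (r : relsym L) (a : 'I_(rarity r) -> M),
        rel_interp a <-> rel_interp (h \o a)].

Variant semiring_op := NZero | NOne | NAdd | NMul.
Variant ring_op := RZero | ROne | RAdd | ROpp | RMul.
Variant group_op := GOne | GInv | GMul.

Definition semiring_sig : signature :=
  @Signature semiring_op void
    (fun f => match f with NZero | NOne => 0 | NAdd | NMul => 2 end)%N
    (of_void nat).

Definition ring_sig : signature :=
  @Signature ring_op void
    (fun f => match f with RZero | ROne => 0 | ROpp => 1 | RAdd | RMul => 2 end)%N
    (of_void nat).

Definition group_sig : signature :=
  @Signature group_op void
    (fun f => match f with GOne => 0 | GInv => 1 | GMul => 2 end)%N
    (of_void nat).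

Definition nat_structure : structure semiring_sig :=
  @Structure semiring_sig nat
    (fun f => match f return ('I_(@farity semiring_sig f) -> nat) -> nat with
      | NZero => fun=> 0
      | NOne => fun=> 1
      | NAdd => fun a => a ord0 + a ord_max
      | NMul => fun a => a ord0 * a ord_max
      end)%N
    (fun r => match r with end).

Definition ring_structure (R : pzRingType) : structure ring_sig :=
  @Structure ring_sig R
    (fun f => match f return ('I_(@farity ring_sig f) -> R) -> R with
      | RZero => fun=> 0
      | ROne => fun=> 1
      | RAdd => fun a => a ord0 + a ord_max
      | ROpp => fun a => - a ord0
      | RMul => fun a => a ord0 * a ord_max
      end)
    (fun r => match r with end).

Definition group_structure (G : groupType) : structure group_sig :=
  @Structure group_sig G
    (fun f => match f return ('I_(@farity group_sig f) -> G) -> G with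
      | GOne => fun=> 1
      | GInv => fun a => (a ord0)^-1
      | GMul => fun a => a ord0 * a ord_max
      end)%g
    (fun r => match r with end).

(* An L-structure interpreted in the language K.  The formulas for symbols have
   several [dim]-tuples of variables: the variable (i, s) is the s-th entry of
   the i-th tuple.  In [fun_formula], the tuple [None] is the value. *)
Record interpretation (K L : signature) := Interpretation {
  dim : nat;
  dom_formula : formula K 'I_dim;
  eq_formula : formula K (bool * 'I_dim);
  fun_formula : forall f : funsym L, formula K (option 'I_(farity f) * 'I_dim);
  rel_formula : forall r : relsym L, formula K ('I_(rarity r) * 'I_dim) }.

Section Interpretation.
Variables (K L : signature) (Gamma : interpretation K L) (B : structure K).

Notation tup := ('I_(dim Gamma) -> B).

Definition holds_at (I : Type) (phi : formula K (I * 'I_(dim Gamma)))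
    (x : I -> tup) : Prop :=
  holds phi (fun p => x p.1 p.2).

Definition in_dom (x : tup) : Prop := holds (dom_formula Gamma) x.

Definition equiv (x y : tup) : Prop :=
  holds_at (eq_formula Gamma) (fun b : bool => if b then y else x).

(* The formulas of Gamma define an L-structure on the quotient of
   [in_dom] by [equiv]. *)
Record admissible : Prop := Admissible {
  equiv_refl : forall x, in_dom x -> equiv x x;
  equiv_sym : forall x y, in_dom x -> in_dom y -> equiv x y -> equiv y x;
  equiv_trans : forall x y z, in_dom x -> in_dom y -> in_dom z ->
    equiv x y -> equiv y z -> equiv x z;
  rel_formula_equiv : forall (r : relsym L) (x y : 'I_(rarity r) -> tup),
    (forall i, in_dom (x i)) -> (forall i, in_dom (y i)) ->
    (forall i, equiv (x i) (y i)) ->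
    holds_at (rel_formula Gamma r) x -> holds_at (rel_formula Gamma r) y;
  fun_formula_equiv : forall (f : funsym L) (x y : option 'I_(farity f) -> tup),
    (forall i, in_dom (x i)) -> (forall i, in_dom (y i)) ->
    (forall i, equiv (x i) (y i)) ->
    holds_at (fun_formula Gamma f) x -> holds_at (fun_formula Gamma f) y;
  fun_formula_total : forall (f : funsym L) (x : 'I_(farity f) -> tup),
    (forall i, in_dom (x i)) ->
    exists2 y, in_dom y & holds_at (fun_formula Gamma f) (oapp x y);
  fun_formula_unique : forall (f : funsym L) (x : 'I_(farity f) -> tup) (y z : tup),
    (forall i, in_dom (x i)) -> in_dom y -> in_dom z ->
    holds_at (fun_formula Gamma f) (oapp x y) ->
    holds_at (fun_formula Gamma f) (oapp x z) -> equiv y z }.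

Definition quotient : Type :=
  {A : tup -> Prop | exists2 x, in_dom x & A = (fun y => in_dom y /\ equiv x y)}.

Definition represents (a : quotient) (x : tup) : Prop := sval a x.

Definition quotient_graph (f : funsym L) (a : 'I_(farity f) -> quotient)
    (b : quotient) : Prop :=
  exists (x : 'I_(farity f) -> tup) (y : tup),
    [/\ forall i, represents (a i) (x i), represents b y &
        holds_at (fun_formula Gamma f) (oapp x y)].

Definition quotient_rel (r : relsym L) (a : 'I_(rarity r) -> quotient) : Prop :=
  exists2 x : 'I_(rarity r) -> tup,
    forall i, represents (a i) (x i) & holds_at (rel_formula Gamma r) x.

Lemma quotient_graph_total (adm : admissible) (f : funsym L)
    (a : 'I_(farity f) -> quotient) :
  exists b, quotient_graph a b.
Proof.
have /boolp.choice [x xP] i : exists x, in_dom x /\ represents (a i) x.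
  rewrite /represents; case: (a i) => A /= [x Ux AE]; exists x.
  rewrite AE; split=> //; split=> //; exact: equiv_refl adm _ Ux.
have [|y Uy fxy] := fun_formula_total adm (x := x); first by move=> i; case: (xP i).
pose b : quotient :=
  exist _ (fun z => in_dom z /\ equiv y z) (ex_intro2 _ _ y Uy erefl).
exists b, x, y; split=> //.
  by move=> i; case: (xP i).
by split=> //; exact: equiv_refl adm _ Uy.
Qed.

(* The L-structure defined by Gamma in B.  By [fun_formula_unique], the value
   chosen by [cid] is the only one related to a by [quotient_graph]. *)
Definition interpreted_structure (adm : admissible) : structure L :=
  @Structure L quotient
    (fun f a => sval (cid (quotient_graph_total adm a)))
    quotient_rel.

End Interpretation.

(* j is the map induced on the interpreted structures by i. *)
Definition induced_by (K L : signature) (Gamma : interpretation K L)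
    (B C : structure K) (i : B -> C)
    (j : quotient Gamma B -> quotient Gamma C) : Prop :=
  forall (a : quotient Gamma B) (x : 'I_(dim Gamma) -> B),
    represents a x -> represents (j a) (i \o x).

(* The letter (i, false) stands for g_i and (i, true) for its inverse. *)
Definition word (k : nat) : Type := seq ('I_k * bool).

Definition word_value (G : groupType) (k : nat) (g : 'I_k -> G)
    (w : word k) : G :=
  (\prod_(p <- w) (if p.2 then (g p.1)^-1 else g p.1))%g.

Definition generates (G : groupType) (k : nat) (g : 'I_k -> G) : Prop :=
  forall x : G, exists w : word k, word_value g w = x.

Definition word_code (k : nat) (w : word k) : nat :=
  CodeSeq.code [seq ((p.1 : nat).*2 + p.2)%N | p : 'I_k * bool <- w].

Definition arithmetic_word_problem (G : groupType) (k : nat) (g : 'I_k -> G) : Prop :=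
  exists phi : formula semiring_sig unit, forall m : nat,
    @holds _ nat_structure _ phi (fun=> m) <->
    exists2 w : word k, word_code w = m & word_value g w = 1%g.

(* Main.v *)
Require Import Defs.
From mathcomp Require Import all_boot all_algebra.
From mathcomp Require Import boolp.
Import Defs.

(** Every integer is the value of a closed term, so elementary equivalence
    alone makes the canonical map from the integers to [Zt] elementary.
    Relativising quantifiers to the domain of [Gamma] and replacing equality by
    its equivalence turns a formula about the interpreted structure into one
    about the interpreting structure, uniformly in the latter.  Hence an
    elementary embedding of interpreting structures preserves admissibility and
    induces an elementary embedding of the interpreted structures. *)

Set Implicit Arguments.
Unset Strict Implicit.
Unset Printing Implicit Defensive.

(** * Substitution of terms into formulas, and invariance of truth under isomorphism *)

Section Substitution.
Variable L : signature.

Fixpoint subst_term (X Y : Type) (s : X -> term L Y) (t : term L X) : term L Y :=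
  match t with
  | Var x => s x
  | App f ts => App (fun i => subst_term s (ts i))
  end.

(** The bound variable [None] is kept, and the variables of the substituted terms are shifted by
    [Some] so that none is captured. *)
Definition lift_subst (X Y : Type) (s : X -> term L Y) :
    option X -> term L (option Y) :=
  oapp (fun x => subst_term (fun y => Var L (Some y)) (s x)) (Var L None).

(** [Y] is quantified after [phi] because each quantifier changes the target to [option Y] as
    well. *)
Fixpoint subst (X : Type) (phi : formula L X) :
    forall Y : Type, (X -> term L Y) -> formula L Y :=
  match phi with
  | Falsum => fun Y s => Falsum L Y
  | Equal t u => fun Y s => Equal (subst_term s t) (subst_term s u)
  | Rel r ts => fun Y s => Rel (fun i => subst_term s (ts i))
  | Imp p q => fun Y s => Imp (subst p s) (subst q s)
  | And p q => fun Y s => And (subst p s) (subst q s)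
  | Or p q => fun Y s => Or (subst p s) (subst q s)
  | All p => fun Y s => All (subst p (lift_subst s))
  | Ex p => fun Y s => Ex (subst p (lift_subst s))
  end.

Variable M : structure L.

Lemma eval_subst (X Y : Type) (s : X -> term L Y) (e : Y -> M) (t : term L X) :
  eval e (subst_term s t) = eval (fun x => eval e (s x)) t.
Proof.
elim: t => [//|f ts IH] /=; congr fun_interp.
by apply: funext => i; exact: IH.
Qed.

Lemma eval_lift_subst (X Y : Type) (s : X -> term L Y) (e : Y -> M) (a : M) :
  (fun x => eval (oapp e a) (lift_subst s x)) =
  oapp (fun x => eval e (s x)) a.
Proof. by apply: funext => -[x|] //=; rewrite eval_subst. Qed.

Lemma holds_subst (X : Type) (phi : formula L X) (Y : Type)
    (s : X -> term L Y) (e : Y -> M) :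
  holds (subst phi s) e <-> holds phi (fun x => eval e (s x)).
Proof.
elim: X / phi Y s e => [X|X t u|X r ts|X p IHp q IHq|X p IHp q IHq
  |X p IHp q IHq|X p IH|X p IH] Y s e //=.
- by rewrite !eval_subst.
- by under [X in rel_interp X]funext => i do rewrite eval_subst.
- by rewrite (propext (IHp Y s e)) (propext (IHq Y s e)).
- by rewrite (propext (IHp Y s e)) (propext (IHq Y s e)).
- by rewrite (propext (IHp Y s e)) (propext (IHq Y s e)).
- by split=> H a; move: (H a); rewrite (propext (IH _ _ _)) eval_lift_subst.
- by split=> -[a]; rewrite ?(propext (IH _ _ _)) => H; exists a;
    move: H; rewrite ?(propext (IH _ _ _)) eval_lift_subst.
Qed.

End Substitution.

(** Injectivity of [h] reflects equations; surjectivity turns each quantified element of [N] into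
    some [h a], which is what the quantifier cases need. *)
Lemma holds_isomorphism (L : signature) (M N : structure L) (h : M -> N)
    (X : Type) (phi : formula L X) (e : X -> M) :
  isomorphism h -> holds phi e <-> holds phi (h \o e).
Proof.
move=> [[h' hK h'K] h_fun h_rel].
have h_eval Y (e' : Y -> M) t : eval (h \o e') t = h (eval e' t).
  elim: t => [//|f ts IH] /=; rewrite h_fun; congr fun_interp.
  by apply: funext => i; exact: IH.
have h_oapp Y (e' : Y -> M) a : oapp (h \o e') (h a) = h \o oapp e' a.
  by apply: funext => -[].
elim: X / phi e => [X|X t u|X r ts|X p IHp q IHq|X p IHp q IHq
  |X p IHp q IHq|X p IH|X p IH] e //=.
- by rewrite !h_eval; split=> [->//|]; exact: (can_inj hK).
- under [X in _ <-> rel_interp X]funext => i do rewrite h_eval.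
  exact: h_rel.
- by rewrite (propext (IHp e)) (propext (IHq e)).
- by rewrite (propext (IHp e)) (propext (IHq e)).
- by rewrite (propext (IHp e)) (propext (IHq e)).
- split=> H a; last by apply/IH; rewrite -h_oapp; exact: H.
  by rewrite -(h'K a) h_oapp; apply/IH; exact: H.
- split=> -[a H]; first by exists (h a); rewrite h_oapp; apply/IH.
  by exists (h' a); apply/IH; rewrite -h_oapp h'K.
Qed.

(** * Closed terms naming the integers, and the integers as an elementary subring *)

Section IntegerTerms.
Import GRing.Theory.
Local Open Scope ring_scope.

(** The empty tuple of arguments, used for the constants 0 and 1. *)
Definition const_args (T : Type) (i : 'I_0) : T :=
  match i with Ordinal _ lt_i0 => match notF lt_i0 with end end.

Fixpoint nat_term (X : Type) (n : nat) : term ring_sig X :=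
  if n is n'.+1 then
    @App ring_sig X RAdd (fun i : 'I_2 => if i == ord0
      then @App ring_sig X ROne (@const_args _) else nat_term X n')
  else @App ring_sig X RZero (@const_args _).

(** [Negz n] is the integer -(n+1), hence the numeral of [n.+1] under the minus sign. *)
Definition int_term (X : Type) (z : int) : term ring_sig X :=
  match z with
  | Posz n => nat_term X n
  | Negz n => @App ring_sig X ROpp (fun=> nat_term X n.+1)
  end.

Variable R : pzRingType.

Lemma eval_nat_term (X : Type) (e : X -> ring_structure R) (n : nat) :
  eval e (nat_term X n) = n%:R.
Proof. by elim: n => [//|n IH] /=; rewrite IH mulrS. Qed.

Lemma eval_int_term (X : Type) (e : X -> ring_structure R) (z : int) :
  eval e (int_term X z) = z%:~R.
Proof.
case: z => n; first exact: eval_nat_term.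
by rewrite NegzE mulrNz; rewrite -pmulrn -(eval_nat_term e).
Qed.

End IntegerTerms.

Lemma int_elementary_embedding (R : pzRingType) :
  elementarily_equivalent (ring_structure R) (ring_structure int) ->
  @elementary_embedding _ (ring_structure int) (ring_structure R)
    (fun z : int => z%:~R%R).
Proof.
move=> R_equiv n phi e.
(* Replacing the parameters [e i] by closed terms leaves a sentence, to which elementary equivalence
   applies. *)
pose closed : formula ring_sig void := subst phi (fun i => int_term void (e i)).
have closedP (S : pzRingType) :
    @holds _ (ring_structure S) _ closed (of_void S) <->
    @holds _ (ring_structure S) _ phi (fun i => (e i)%:~R%R).
  rewrite (propext (holds_subst _ _ _)).
  by under [X in holds phi X <-> _]funext => i do rewrite eval_int_term.
rewrite -[X in _ <-> X](propext (closedP R)) (propext (R_equiv closed)).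
rewrite (propext (closedP int)).
by under [X in _ <-> holds phi X]funext => i do rewrite intz.
Qed.

(** * Predicates definable uniformly in all structures *)

Section Definability.
Variable K : signature.

(* One formula defines [P] in all structures at once. *)
Definition definable (X : Type) (P : forall B : structure K, (X -> B) -> Prop) :=
  exists phi : formula K X, forall B e, holds phi e <-> P B e.

Lemma definable_holds (X Y : Type) (phi : formula K X) (f : X -> Y) :
  definable (fun B (e : Y -> B) => holds phi (e \o f)).
Proof.
by exists (subst phi (fun x => Var K (f x))) => B e; exact: holds_subst.
Qed.

Lemma definable_iff (X : Type) (P Q : forall B : structure K, (X -> B) -> Prop) :
  (forall B e, P B e <-> Q B e) -> definable P -> definable Q.
Proof.
by move=> PQ [phi phiP]; exists phi => B e; rewrite -(propext (PQ B e)).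
Qed.

Lemma definable_imp (X : Type) (P Q : forall B : structure K, (X -> B) -> Prop) :
  definable P -> definable Q -> definable (fun B e => P B e -> Q B e).
Proof.
move=> [p pP] [q qP]; exists (Imp p q) => B e.
by rewrite /= (propext (pP B e)) (propext (qP B e)).
Qed.

Lemma definable_not (X : Type) (P : forall B : structure K, (X -> B) -> Prop) :
  definable P -> definable (fun B e => ~ P B e).
Proof. by move=> /definable_imp; apply; exists (Falsum K X). Qed.

Lemma definable_and (X : Type) (P Q : forall B : structure K, (X -> B) -> Prop) :
  definable P -> definable Q -> definable (fun B e => P B e /\ Q B e).
Proof.
move=> [p pP] [q qP]; exists (And p q) => B e.
by rewrite /= (propext (pP B e)) (propext (qP B e)).
Qed.

Lemma definable_or (X : Type) (P Q : forall B : structure K, (X -> B) -> Prop) :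
  definable P -> definable Q -> definable (fun B e => P B e \/ Q B e).
Proof.
move=> [p pP] [q qP]; exists (Or p q) => B e.
by rewrite /= (propext (pP B e)) (propext (qP B e)).
Qed.

(** Since [I] is finite, this is a conjunction of formulas along [enum I]. *)
Lemma definable_forall_in (X : Type) (I : finType)
    (P : I -> forall B : structure K, (X -> B) -> Prop) :
  (forall i, definable (P i)) -> definable (fun B e => forall i, P i B e).
Proof.
move=> P_def.
suff [phi phiP] : definable (fun B e => forall i, i \in enum I -> P i B e).
  exists phi => B e; rewrite (propext (phiP B e)).
  by split=> H i; [apply: H; rewrite mem_enum|].
elim: (enum I) => [|i s].
  (* The empty conjunction is truth, written as [Falsum] implying itself. *)
  by exists (Imp (Falsum K X) (Falsum K X)) => B e; split=> _ // i; rewrite ?in_nil.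
move=> /(definable_and (P_def i)); apply: definable_iff => B e; split.
  by move=> [Pi Ps] j; rewrite inE => /predU1P[->|/Ps].
by move=> H; split=> [|j js]; apply: H; rewrite inE ?eqxx ?js ?orbT.
Qed.

Lemma definable_rename (X Y : Type) (f : X -> Y)
    (P : forall B : structure K, (X -> B) -> Prop) :
  definable P -> definable (fun B (e : Y -> B) => P B (e \o f)).
Proof.
move=> [phi phiP]; apply: definable_iff (definable_holds phi f) => B e.
exact: phiP.
Qed.

(** A quantifier over [d]-tuples becomes [d] nested quantifiers: by induction on [d], the first
    coordinate is bound by [All] and the tail is left to the induction hypothesis. *)
Lemma definable_forall_ord (d : nat) (X : Type)
    (P : forall B : structure K, (X -> B) -> ('I_d -> B) -> Prop) :
  definable (fun B (e : X + 'I_d -> B) => P B (e \o inl) (e \o inr)) ->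
  definable (fun B e => forall y : 'I_d -> B, P B e y).
Proof.
elim: d X P => [|d IH] X P P_def.
  pose f (u : X + 'I_0) : X := match u with inl x => x | inr i => const_args X i end.
  apply: definable_iff (definable_rename f P_def) => B e.
  have I0_fun (y y' : 'I_0 -> B) : y = y' by apply: funext => -[].
  split=> [H y|]; last by apply.
  by rewrite (I0_fun y ((e \o f) \o inr)).
(* Coordinate 0 becomes the variable [None] bound by the outer quantifier; coordinate j+1 becomes
   coordinate j of the tail. *)
pose f (u : X + 'I_d.+1) : option X + 'I_d :=
  match u with
  | inl x => inl (Some x)
  | inr i => if unlift ord0 i is Some j then inr j else inl None
  end.
pose cons B (a : B) (y : 'I_d -> B) (i : 'I_d.+1) :=
  if unlift ord0 i is Some j then y j else a.
have [|phi phiP] := IH (option X)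
    (fun B e y => P B (e \o Some) (cons B (e None) y)).
  apply: definable_iff (definable_rename f P_def) => B e.
  suff -> : (e \o f) \o inr = cons B (e (inl None)) (e \o inr) by [].
  by apply: funext => i; rewrite /f /cons /=; case: unlift.
exists (All phi) => B e; split=> [H y|H a].
  have /phiP /(_ (y \o lift ord0)) := H (y ord0).
  suff -> : cons B (y ord0) (y \o lift ord0) = y by [].
  by apply: funext => i; rewrite /cons; case: unliftP => [j|] ->.
by apply/phiP => y; exact: H.
Qed.

Lemma definable_forall (I : finType) (X : Type)
    (P : forall B : structure K, (X -> B) -> (I -> B) -> Prop) :
  definable (fun B (e : X + I -> B) => P B (e \o inl) (e \o inr)) ->
  definable (fun B e => forall y : I -> B, P B e y).
Proof.
pose f (u : X + I) : X + 'I_#|I| :=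
  match u with inl x => inl x | inr i => inr (enum_rank i) end.
move=> /(definable_rename f) P_def.
have := @definable_forall_ord _ X (fun B e y => P B e (y \o enum_rank)) P_def.
apply: definable_iff => B e; split=> H y; last exact: H.
have := H (y \o enum_val).
suff -> : (y \o enum_val) \o enum_rank = y by [].
by apply: funext => i /=; rewrite enum_rankK.
Qed.

(** [elementary_embedding] speaks only of variables in some ['I_n], so the finite type [X] is first
    renamed through [enum_rank]. *)
Lemma elementary_definable (B C : structure K) (i : B -> C) (X : finType)
    (P : forall B : structure K, (X -> B) -> Prop) (e : X -> B) :
  elementary_embedding i -> definable P -> P B e <-> P C (i \o e).
Proof.
move=> i_elem [phi phiP].
rewrite -(propext (phiP _ _)) -(propext (phiP _ _)).
pose psi := subst phi (fun x => Var K (enum_rank x)).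
have psiP (D : structure K) (e' : X -> D) :
    holds phi e' <-> holds psi (e' \o enum_val).
  rewrite (propext (holds_subst _ _ _)).
  by under [X in _ <-> holds phi X]funext => x do rewrite /= enum_rankK.
by rewrite (propext (psiP _ _)) (propext (psiP _ (i \o e))); exact: i_elem.
Qed.

End Definability.

(** * Definability of predicates on tuples of length [dim Gamma] *)

Section Translation.
Variables (K L : signature) (Gamma : interpretation K L).

Notation tup B := ('I_(dim Gamma) -> carrier B).

(** Here the variables range over tuples: [T] indexes the tuples, and (t, s) is the s-th entry of
    the tuple t, as in the formulas of an interpretation. *)
Definition tdefinable (T : Type)
    (P : forall B : structure K, (T -> tup B) -> Prop) :=
  definable (fun B (e : T * 'I_(dim Gamma) -> B) => P B (fun t s => e (t, s))).

Lemma tdefinable_rename (T T' : Type) (f : T -> T')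
    (P : forall B : structure K, (T -> tup B) -> Prop) :
  tdefinable P -> tdefinable (fun B (x : T' -> tup B) => P B (x \o f)).
Proof. exact: definable_rename (fun p : T * _ => (f p.1, p.2)) _. Qed.

(** Used to feed an already named tuple [x t] into the place [None], which in graph formulas holds
    the value. *)
Lemma tdefinable_oapp (T T' : Type) (f : T -> T') (t : T')
    (P : forall B : structure K, (option T -> tup B) -> Prop) :
  tdefinable P ->
  tdefinable (fun B (x : T' -> tup B) => P B (oapp (x \o f) (x t))).
Proof.
move=> /(tdefinable_rename (oapp f t)); apply: definable_iff => B e.
pose x t' s := e (t', s).
have -> : oapp (x \o f) (x t) = x \o oapp f t by apply: funext => -[].
by [].
Qed.

Lemma tdefinable_holds_at (I T : Type) (phi : formula K (I * 'I_(dim Gamma)))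
    (f : I -> T) :
  tdefinable (fun B (x : T -> tup B) => holds_at phi (x \o f)).
Proof. exact: definable_holds phi (fun p => (f p.1, p.2)). Qed.

Lemma tdefinable_in_dom (T : Type) (t : T) :
  tdefinable (fun B (x : T -> tup B) => in_dom (x t)).
Proof. exact: definable_holds (dom_formula Gamma) (fun s => (t, s)). Qed.

Lemma tdefinable_equiv (T : Type) (t u : T) :
  tdefinable (fun B (x : T -> tup B) => equiv (x t) (x u)).
Proof.
have := tdefinable_holds_at (eq_formula Gamma) (fun b : bool => if b then u else t).
apply: definable_iff => B e; rewrite /equiv.
set x := (X in holds_at _ X <-> _); set y := (X in _ <-> holds_at _ X).
by have -> : x = y by apply: funext => -[].
Qed.

Lemma tdefinable_forall (T : Type) (I : finType)
    (P : forall B : structure K, (T -> tup B) -> (I -> tup B) -> Prop) :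
  tdefinable (fun B (x : T + I -> tup B) => P B (x \o inl) (x \o inr)) ->
  tdefinable (fun B x => forall y : I -> tup B, P B x y).
Proof.
(* Product distributes over sum, so that a family of tuples indexed by [I] becomes a single family
   of elements indexed by [I * 'I_(dim Gamma)]. *)
pose f (p : (T + I) * 'I_(dim Gamma)) :=
  match p.1 with inl t => inl (t, p.2) | inr i => inr (i, p.2) end.
move=> /(definable_rename f) P_def.
have := @definable_forall K (I * 'I_(dim Gamma))%type _
  (fun B e y => P B (fun t s => e (t, s)) (fun i s => y (i, s))) P_def.
apply: definable_iff => B e; split=> H y; last exact: H.
exact: H (fun p => y p.1 p.2).
Qed.

(** Obtained classically, as the negation of a universal statement. *)
Lemma tdefinable_exists (T : Type) (I : finType)
    (P : forall B : structure K, (T -> tup B) -> (I -> tup B) -> Prop) :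
  tdefinable (fun B (x : T + I -> tup B) => P B (x \o inl) (x \o inr)) ->
  tdefinable (fun B x => exists y : I -> tup B, P B x y).
Proof.
move=> /definable_not /(tdefinable_forall (P := fun B x y => ~ P B x y)).
move=> /definable_not; apply: definable_iff => B e.
by split=> [/existsNP [y /contrapT]|[y Py]]; [exists y|apply/existsNP; exists y].
Qed.

Lemma tdefinable_forall1 (T : Type)
    (P : forall B : structure K, (T -> tup B) -> tup B -> Prop) :
  tdefinable (fun B (x : option T -> tup B) => P B (x \o Some) (x None)) ->
  tdefinable (fun B x => forall y : tup B, P B x y).
Proof.
move=> /(tdefinable_rename (oapp inl (inr tt))).
move=> /(tdefinable_forall (P := fun B x (y : unit -> _) => P B x (y tt))).
by apply: definable_iff => B e; split=> H y; [exact: (H (fun=> y))|exact: H].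
Qed.

Lemma tdefinable_exists1 (T : Type)
    (P : forall B : structure K, (T -> tup B) -> tup B -> Prop) :
  tdefinable (fun B (x : option T -> tup B) => P B (x \o Some) (x None)) ->
  tdefinable (fun B x => exists y : tup B, P B x y).
Proof.
move=> /(tdefinable_rename (oapp inl (inr tt))).
move=> /(tdefinable_exists (P := fun B x (y : unit -> _) => P B x (y tt))).
apply: definable_iff => B e.
by split=> -[y Py]; [exists (y tt)|exists (fun=> y)].
Qed.

(** * Elements of the quotient and their representatives *)

Section Representatives.
Variables (B : structure K) (adm : admissible Gamma B).

Lemma represents_in_dom (a : quotient Gamma B) (x : tup B) :
  represents a x -> in_dom x.
Proof. by case: a => A [x0 Ux0 AE]; rewrite /represents /= AE => -[]. Qed.

Lemma exists_representative (a : quotient Gamma B) : exists x, represents a x.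
Proof.
case: a => A [x Ux AE]; exists x; rewrite /represents /= AE.
by split=> //; exact: (equiv_refl adm Ux).
Qed.

Lemma exists_represented (x : tup B) :
  in_dom x -> exists a : quotient Gamma B, represents a x.
Proof.
move=> Ux.
exists (exist _ (fun y => in_dom y /\ equiv x y) (ex_intro2 _ _ x Ux erefl)).
by split=> //; exact: (equiv_refl adm Ux).
Qed.

(** Symmetry and transitivity let any representative replace the one from which the class was
    formed. *)
Lemma representsE (a : quotient Gamma B) (x y : tup B) :
  represents a x -> represents a y <-> in_dom y /\ equiv x y.
Proof.
case: a => A [x0 Ux0 AE]; rewrite /represents /= AE => -[Ux x0x].
split=> -[Uy xy]; split=> //; last exact: (equiv_trans adm Ux0 Ux Uy x0x xy).
by apply: (equiv_trans adm Ux Ux0 Uy _ xy); exact: (equiv_sym adm Ux0 Ux x0x).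
Qed.

Lemma represents_eq (a b : quotient Gamma B) (x y : tup B) :
  represents a x -> represents b y -> a = b <-> equiv x y.
Proof.
move=> ax b_y; split=> [ab|xy].
  by move: b_y; rewrite -ab => /(representsE _ ax) [].
have Ux := represents_in_dom ax; have Uy := represents_in_dom b_y.
(* By proof irrelevance a class is determined by its underlying predicate. *)
have sval_inj (c c' : quotient Gamma B) : sval c = sval c' -> c = c'.
  by case: c c' => [A AP] [A' A'P] /= AA'; exact: eq_exist.
apply: sval_inj; apply: funext => z; apply: propext.
apply: iff_trans (representsE z ax) _.
apply: iff_trans (iff_sym (representsE z b_y)).
split=> -[Uz E]; split=> //; last exact: (equiv_trans adm Ux Uy Uz xy E).
exact: (equiv_trans adm Uy Ux Uz (equiv_sym adm Ux Uy xy) E).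
Qed.

Lemma fun_interpE (f : funsym L) (a : 'I_(farity f) -> interpreted_structure adm)
    (b : interpreted_structure adm) (x : 'I_(farity f) -> tup B) (y : tup B) :
  (forall i, represents (a i) (x i)) -> represents b y ->
  fun_interp a = b <-> holds_at (fun_formula Gamma f) (oapp x y).
Proof.
move=> ax b_y; set c := fun_interp a.
(* The chosen value comes with representatives [x'] and [y'] of its own. Congruence carries the
   graph formula over to [x] and [y]; in the converse direction, uniqueness then identifies [y']
   with [y]. *)
have [x' [y' [ax' cy' fx'y']]] : quotient_graph a c := svalP (cid _).
have Ux i := represents_in_dom (ax i).
have Ux' i := represents_in_dom (ax' i).
have Uy := represents_in_dom b_y; have Uy' := represents_in_dom cy'.
have x'x i : equiv (x' i) (x i) by case/(representsE _ (ax' i)): (ax i).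
apply: iff_trans (represents_eq cy' b_y) _; split=> [y'y|fxy].
  by apply: (fun_formula_equiv adm _ _ _ fx'y') => -[].
apply: (fun_formula_unique adm Ux Uy' Uy _ fxy).
by apply: (fun_formula_equiv adm _ _ _ fx'y') => -[] //=; exact: (equiv_refl adm Uy').
Qed.

Lemma rel_interpE (r : relsym L) (a : 'I_(rarity r) -> interpreted_structure adm)
    (x : 'I_(rarity r) -> tup B) :
  (forall i, represents (a i) (x i)) ->
  rel_interp a <-> holds_at (rel_formula Gamma r) x.
Proof.
move=> ax; split=> [[x' ax' rx']|rx]; last by exists x.
apply: (rel_formula_equiv adm _ _ _ rx') => i.
- exact: represents_in_dom (ax' i).
- exact: represents_in_dom (ax i).
- by case/(representsE _ (ax' i)): (ax i).
Qed.

End Representatives.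

(** * Translation of terms and formulas through the interpretation *)

Definition translates_term (X : Type) (t : term L X)
    (P : forall B : structure K, (option X -> tup B) -> Prop) : Prop :=
  tdefinable P /\
  forall (B : structure K) (adm : admissible Gamma B)
    (a : X -> interpreted_structure adm) (b : interpreted_structure adm)
    (x : X -> tup B) (y : tup B),
    (forall v, represents (a v) (x v)) -> represents b y ->
    P B (oapp x y) <-> eval a t = b.

(** An interpretation gives operations only by their graphs, so a term translates to the graph of
    its value, with the value in place [None]. A compound term is unravelled by quantifying over
    tuples for the values of its arguments. *)
Lemma term_translation (X : Type) (t : term L X) : exists P, translates_term t P.
Proof.
elim: t => [v|f ts IH].
  exists (fun B x => equiv (x (Some v)) (x None)).
  split=> [|B adm a b x y ax b_y]; first exact: tdefinable_equiv.
  by apply: iff_sym; exact: represents_eq (ax v) b_y.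
have /boolp.choice [P PP] := IH.
exists (fun B x => exists y : 'I_(farity f) -> tup B,
  (forall i, in_dom (y i) /\ P i B (oapp (x \o Some) (y i))) /\
  holds_at (fun_formula Gamma f) (oapp y (x None))).
split.
  apply: tdefinable_exists; apply: definable_and.
    apply: definable_forall_in => i; apply: definable_and.
      exact: (tdefinable_in_dom (inr i)).
    exact: (tdefinable_oapp (inl \o Some) (inr i) (PP i).1).
  exact: (tdefinable_oapp inr (inl None) (tdefinable_holds_at _ id)).
move=> B adm a b x y ax b_y; split=> [[z [zP fzy]]|].
  (* As [z i] lies in the domain it represents some class [c], which the induction hypothesis forces
     to be the value of the argument. *)
  have tz i : represents (eval a (ts i)) (z i).
    have [Uz Piz] := zP i; have [c cz] := exists_represented adm Uz.
    by rewrite (((PP i).2 B adm a c x (z i) ax cz).1 Piz).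
  exact: (fun_interpE tz b_y).2 fzy.
move=> tb; have /boolp.choice [z zP] i := exists_representative adm (eval a (ts i)).
exists z; split=> [i|]; last exact: (fun_interpE zP b_y).1 tb.
by split; [exact: represents_in_dom (zP i)|apply/((PP i).2 B adm a _ x (z i) ax (zP i))].
Qed.

Lemma represents_oapp (X : Type) (B : structure K) (a : X -> quotient Gamma B)
    (b : quotient Gamma B) (x : X -> tup B) (y : tup B) :
  (forall v, represents (a v) (x v)) -> represents b y ->
  forall v, represents (oapp a b v) (oapp x y v).
Proof. by move=> ax b_y [v|] //=. Qed.

(** [P] is fixed before [B], so one formula describes truth of [phi] in all interpreted structures.
    Relativised quantifiers are faithful because every class has a representative and every tuple in
    the domain represents a class. *)
Lemma formula_translation (X : Type) (phi : formula L X) :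
  exists2 P : forall B : structure K, (X -> tup B) -> Prop,
    tdefinable P &
    forall (B : structure K) (adm : admissible Gamma B)
      (a : X -> interpreted_structure adm) (x : X -> tup B),
      (forall v, represents (a v) (x v)) -> P B x <-> holds phi a.
Proof.
elim: X / phi => [X|X t u|X r ts|X p [P P_def PP] q [Q Q_def QP]
  |X p [P P_def PP] q [Q Q_def QP]|X p [P P_def PP] q [Q Q_def QP]
  |X p [P P_def PP]|X p [P P_def PP]].
- by exists (fun _ _ => False) => //; exists (Falsum K _).
- have [P [P_def PP]] := term_translation t.
  have [Q [Q_def QP]] := term_translation u.
  (* An equation says that one tuple [y] represents the value of both sides. *)
  exists (fun B x => exists y, in_dom y /\ (P B (oapp x y) /\ Q B (oapp x y))).
    apply: tdefinable_exists1; apply: definable_and.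
      exact: (tdefinable_in_dom None).
    by apply: definable_and; exact: tdefinable_oapp.
  move=> B adm a x ax /=; split=> [[y [Uy [Py Qy]]]|tu].
    have [b b_y] := exists_represented adm Uy.
    by move/(PP _ _ _ _ _ _ ax b_y): Py => ->; move/(QP _ _ _ _ _ _ ax b_y): Qy => ->.
  have [y ty] := exists_representative adm (eval a t).
  exists y; split; first exact: represents_in_dom ty.
  by split; [apply/(PP _ _ _ _ _ _ ax ty)|apply/(QP _ _ _ _ _ _ ax ty)].
- have /boolp.choice [P PP] := fun i => term_translation (ts i).
  exists (fun B x => exists y : 'I_(rarity r) -> tup B,
    (forall i, in_dom (y i) /\ P i B (oapp x (y i))) /\
    holds_at (rel_formula Gamma r) y).
    apply: tdefinable_exists; apply: definable_and.
      apply: definable_forall_in => i; apply: definable_and.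
        exact: (tdefinable_in_dom (inr i)).
      exact: (tdefinable_oapp inl (inr i) (PP i).1).
    exact: (tdefinable_holds_at _ inr).
  move=> B adm a x ax; split=> [[z [zP rz]]|].
    have tz i : represents (eval a (ts i)) (z i).
      have [Uz Piz] := zP i; have [c cz] := exists_represented adm Uz.
      by rewrite (((PP i).2 B adm a c x (z i) ax cz).1 Piz).
    exact: (rel_interpE tz).2 rz.
  have /boolp.choice [z zP] i := exists_representative adm (eval a (ts i)).
  move=> /(rel_interpE zP) rz; exists z; split=> // i.
  by split; [exact: represents_in_dom (zP i)|apply/((PP i).2 B adm a _ x (z i) ax (zP i))].
- exists (fun B x => P B x -> Q B x); first exact: definable_imp.
  by move=> B adm a x ax /=; rewrite (propext (PP _ _ _ _ ax)) (propext (QP _ _ _ _ ax)).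
- exists (fun B x => P B x /\ Q B x); first exact: definable_and.
  by move=> B adm a x ax /=; rewrite (propext (PP _ _ _ _ ax)) (propext (QP _ _ _ _ ax)).
- exists (fun B x => P B x \/ Q B x); first exact: definable_or.
  by move=> B adm a x ax /=; rewrite (propext (PP _ _ _ _ ax)) (propext (QP _ _ _ _ ax)).
- exists (fun B x => forall y, in_dom y -> P B (oapp x y)).
    apply: tdefinable_forall1; apply: definable_imp.
      exact: (tdefinable_in_dom None).
    exact: tdefinable_oapp.
  move=> B adm a x ax /=; split=> [H b|H y Uy].
    have [y b_y] := exists_representative adm b.
    by apply/(PP _ _ _ _ (represents_oapp ax b_y)); apply: H; exact: represents_in_dom b_y.
  have [b b_y] := exists_represented adm Uy.
  by apply/(PP _ adm _ _ (represents_oapp ax b_y)); exact: H.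
- exists (fun B x => exists y, in_dom y /\ P B (oapp x y)).
    apply: tdefinable_exists1; apply: definable_and.
      exact: (tdefinable_in_dom None).
    exact: tdefinable_oapp.
  move=> B adm a x ax /=; split=> [[y [Uy Py]]|[b pb]].
    have [b b_y] := exists_represented adm Uy.
    by exists b; apply/(PP _ adm _ _ (represents_oapp ax b_y)).
  have [y b_y] := exists_representative adm b.
  exists y; split; first exact: represents_in_dom b_y.
  by apply/(PP _ _ _ _ (represents_oapp ax b_y)).
Qed.

(** * Transfer along an elementary embedding of the interpreting structures *)

Section ElementaryExtension.
Variables (B C : structure K) (i : B -> C).
Hypothesis i_elem : elementary_embedding i.

Lemma elementary_tdefinable (T : finType)
    (P : forall B : structure K, (T -> tup B) -> Prop) (x : T -> tup B) :
  tdefinable P -> P B x <-> P C (fun t => i \o x t).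
Proof. exact: (elementary_definable (fun p : T * _ => x p.1 p.2)). Qed.

Lemma elementary_sentence (P : structure K -> Prop) :
  tdefinable (T := void) (fun B _ => P B) -> P B <-> P C.
Proof. exact: (elementary_tdefinable (of_void _)). Qed.

Lemma elementary_in_dom (x : tup B) : in_dom x <-> in_dom (i \o x).
Proof. exact: (elementary_tdefinable (fun=> x) (tdefinable_in_dom tt)). Qed.

Lemma elementary_equiv (x y : tup B) : equiv x y <-> equiv (i \o x) (i \o y).
Proof.
have := elementary_tdefinable (fun b : bool => if b then y else x)
  (tdefinable_equiv false true).
by [].
Qed.

(** Arities and [dim Gamma] are finite, so each clause of admissibility, for each symbol, is a
    first-order sentence and passes from [B] to [C]. *)
Lemma elementary_admissible : admissible Gamma B -> admissible Gamma C.
Proof.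
move=> admB; split.
- apply: (elementary_sentence (P := fun B => forall x : tup B, in_dom x -> equiv x x) _).1;
    last by move=> x; exact: equiv_refl.
  apply: tdefinable_forall1; apply: definable_imp.
    exact: (tdefinable_in_dom None).
  exact: (tdefinable_equiv None None).
- apply: (elementary_sentence (P := fun B => forall x y : tup B,
    in_dom x -> in_dom y -> equiv x y -> equiv y x) _).1;
    last by move=> x y; exact: equiv_sym.
  do 2!apply: tdefinable_forall1.
  apply: definable_imp; first exact: (tdefinable_in_dom (Some None)).
  apply: definable_imp; first exact: (tdefinable_in_dom None).
  apply: definable_imp; first exact: (tdefinable_equiv (Some None) None).
  exact: (tdefinable_equiv None (Some None)).
- apply: (elementary_sentence (P := fun B => forall x y z : tup B,
    in_dom x -> in_dom y -> in_dom z -> equiv x y -> equiv y z -> equiv x z) _).1;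
    last by move=> x y z; exact: equiv_trans.
  (* The tuple bound last is [None], and each earlier one gains a [Some]: [x], [y], [z] are now
     [Some (Some None)], [Some None], [None]. *)
  do 3!apply: tdefinable_forall1.
  apply: definable_imp; first exact: (tdefinable_in_dom (Some (Some None))).
  apply: definable_imp; first exact: (tdefinable_in_dom (Some None)).
  apply: definable_imp; first exact: (tdefinable_in_dom None).
  apply: definable_imp; first exact: (tdefinable_equiv (Some (Some None)) (Some None)).
  apply: definable_imp; first exact: (tdefinable_equiv (Some None) None).
  exact: (tdefinable_equiv (Some (Some None)) None).
- move=> r; apply: (elementary_sentence (P := fun B =>
    forall x y : 'I_(rarity r) -> tup B,
    (forall i, in_dom (x i)) -> (forall i, in_dom (y i)) ->
    (forall i, equiv (x i) (y i)) ->
    holds_at (rel_formula Gamma r) x -> holds_at (rel_formula Gamma r) y) _).1;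
    last by move=> x y; exact: rel_formula_equiv.
  (* For families the outer [x j] is now [inl (inr j)] and the inner [y j] is [inr j]. *)
  do 2!apply: tdefinable_forall.
  apply: definable_imp.
    by apply: definable_forall_in => j; exact: (tdefinable_in_dom (inl (inr j))).
  apply: definable_imp.
    by apply: definable_forall_in => j; exact: (tdefinable_in_dom (inr j)).
  apply: definable_imp.
    by apply: definable_forall_in => j; exact: (tdefinable_equiv (inl (inr j)) (inr j)).
  apply: definable_imp; first exact: (tdefinable_holds_at _ (inl \o inr)).
  exact: (tdefinable_holds_at _ inr).
- move=> f; apply: (elementary_sentence (P := fun B =>
    forall x y : option 'I_(farity f) -> tup B,
    (forall i, in_dom (x i)) -> (forall i, in_dom (y i)) ->
    (forall i, equiv (x i) (y i)) ->
    holds_at (fun_formula Gamma f) x -> holds_at (fun_formula Gamma f) y) _).1;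
    last by move=> x y; exact: fun_formula_equiv.
  do 2!apply: tdefinable_forall.
  apply: definable_imp.
    by apply: definable_forall_in => j; exact: (tdefinable_in_dom (inl (inr j))).
  apply: definable_imp.
    by apply: definable_forall_in => j; exact: (tdefinable_in_dom (inr j)).
  apply: definable_imp.
    by apply: definable_forall_in => j; exact: (tdefinable_equiv (inl (inr j)) (inr j)).
  apply: definable_imp; first exact: (tdefinable_holds_at _ (inl \o inr)).
  exact: (tdefinable_holds_at _ inr).
- move=> f.
  suff total_C : forall x : 'I_(farity f) -> tup C, (forall i, in_dom (x i)) ->
      exists y, in_dom y /\ holds_at (fun_formula Gamma f) (oapp x y).
    by move=> x /total_C [y []]; exists y.
  apply: (elementary_sentence (P := fun B =>
    forall x : 'I_(farity f) -> tup B, (forall i, in_dom (x i)) ->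
    exists y, in_dom y /\ holds_at (fun_formula Gamma f) (oapp x y)) _).1; last first.
    by move=> x /(fun_formula_total admB) [y]; exists y.
  apply: tdefinable_forall; apply: definable_imp.
    by apply: definable_forall_in => j; exact: (tdefinable_in_dom (inr j)).
  apply: (tdefinable_exists1 (P := fun B x y =>
    in_dom y /\ holds_at (fun_formula Gamma f) (oapp (x \o inr) y))).
  apply: definable_and.
    exact: (tdefinable_in_dom None).
  exact: (tdefinable_oapp (Some \o inr) None (tdefinable_holds_at _ id)).
- move=> f; apply: (elementary_sentence (P := fun B =>
    forall (x : 'I_(farity f) -> tup B) (y z : tup B),
    (forall i, in_dom (x i)) -> in_dom y -> in_dom z ->
    holds_at (fun_formula Gamma f) (oapp x y) ->
    holds_at (fun_formula Gamma f) (oapp x z) -> equiv y z) _).1;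
    last by move=> x y z; exact: fun_formula_unique.
  apply: tdefinable_forall; do 2!apply: tdefinable_forall1.
  apply: definable_imp.
    by apply: definable_forall_in => j; exact: (tdefinable_in_dom (Some (Some (inr j)))).
  apply: definable_imp; first exact: (tdefinable_in_dom (Some None)).
  apply: definable_imp; first exact: (tdefinable_in_dom None).
  apply: definable_imp.
    exact: (tdefinable_oapp (Some \o Some \o inr) (Some None) (tdefinable_holds_at _ id)).
  apply: definable_imp.
    exact: (tdefinable_oapp (Some \o Some \o inr) None (tdefinable_holds_at _ id)).
  exact: (tdefinable_equiv (Some None) None).
Qed.

Variables (admB : admissible Gamma B) (admC : admissible Gamma C).

(** Each class is sent to the class of the image of a chosen representative; the choice is harmless
    because [i] preserves the domain and the equivalence. *)
Lemma exists_induced :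
  exists j : interpreted_structure admB -> interpreted_structure admC,
    induced_by i j.
Proof.
have /boolp.choice [j jP] (a : quotient Gamma B) : exists b : quotient Gamma C,
    exists2 x, represents a x & represents b (i \o x).
  have [x ax] := exists_representative admB a.
  have /(exists_represented admC) [b b_ix] :=
    (elementary_in_dom x).1 (represents_in_dom ax).
  by exists b, x.
exists j => a x; have [x' ax' jax'] := jP a.
move=> /(representsE admB _ ax') [Ux x'x]; apply/(representsE admC _ jax').
by split; [exact/elementary_in_dom|exact/elementary_equiv].
Qed.

(** Truth of [phi] on both sides is expressed by the same definable predicate, at representatives
    [x] and at their images [i \o x], so elementarity of [i] suffices. *)
Lemma induced_elementary
    (j : interpreted_structure admB -> interpreted_structure admC) :
  induced_by i j -> elementary_embedding j.
Proof.
move=> j_ind n phi a; have [P P_def PP] := formula_translation phi.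
have /boolp.choice [x ax] v := exists_representative admB (a v).
have jax v : represents ((j \o a) v) (i \o x v) by exact: j_ind.
rewrite -(propext (PP _ _ _ _ ax)) -(propext (PP _ _ _ _ jax)).
exact: elementary_tdefinable.
Qed.

End ElementaryExtension.

End Translation.

Theorem theorem6p2 (G : groupType) (k : nat) (g : 'I_k -> G)
    (g_generates : generates g) (g_wp : arithmetic_word_problem g)
    (Zt : pzRingType)
    (Zt_equiv : elementarily_equivalent (ring_structure Zt) (ring_structure int))
    (Gamma : interpretation ring_sig group_sig)
    (admZ : admissible Gamma (ring_structure int))
    (h : group_structure G -> interpreted_structure admZ)
    (h_iso : isomorphism h) :
  exists (admZt : admissible Gamma (ring_structure Zt))
         (j : interpreted_structure admZ -> interpreted_structure admZt),
    @induced_by _ _ Gamma (ring_structure int) (ring_structure Zt)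
      (fun z : int => (z%:~R)%R) j /\
    elementary_embedding (fun x => j (h x)).
Proof.
have i_elem := int_elementary_embedding Zt_equiv.
pose admZt := elementary_admissible i_elem admZ.
have [j j_ind] := exists_induced i_elem admZ admZt.
exists admZt, j; split=> // n phi e.
(* Truth in the group at [e] is replaced by truth in the structure interpreted in the integers at
   [h \o e], from where [j] is elementary. *)
rewrite (propext (holds_isomorphism phi e h_iso)).
exact: (induced_elementary i_elem j_ind).
Qed.
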